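(* Let $E$ be a Banach space. Then $E$ endowed with its weak topology is an Ascoli space if and only if $E$ is finite-dimensional.
   Context: For a topological space $Z$, $C_k(Z)$ denotes the space of all continuous functions $Z\to\mathbb{R}$ endowed with the compact-open topology. A subset $\mathcal{K}\subset C_k(Z)$ is evenly continuous if the evaluation map $(z,f)\mapsto f(z)$ restricted to $Z\times\mathcal{K}$ is jointly continuous, i.e. for every $z\in Z$, every $f\in\mathcal{K}$ and every neighborhood $O$ of $f(z)$ in $\mathbb{R}$ there are neighborhoods $U_f\subset\mathcal{K}$ of $f$ (in $\mathcal{K}$) and $O_z\subset Z$ of $z$ such that $g(y)\in O$ for all $g\in U_f$, $y\in O_z$. A Tychonoff space $Z$ is called an Ascoli space if every compact subset of $C_k(Z)$ is evenly continuous. *)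

(* Defs.v *)
From HB Require Import structures.
From mathcomp Require Import all_boot all_order all_algebra.
From mathcomp Require Import all_classical all_reals all_analysis.

Set Implicit Arguments.
Unset Strict Implicit.
Unset Printing Implicit Defensive.

Import Order.TTheory GRing.Theory Num.Theory.
Import numFieldNormedType.Exports.

Local Open Scope classical_set_scope.
Local Open Scope ring_scope.

(* The continuous functions Z -> R, with the subspace topology inherited from
   the compact-open topology on all functions; ArrowAsCompactOpen is not
   imported, since it would override the topology of every arrow type. *)
Definition Ck (R : realType) (Z : topologicalType) : Type :=
  initial_topology
    (fun f : continuousType Z R => (f : Z -> R) : {compact-open, Z -> R}).

HB.instance Definition _ (R : realType) (Z : topologicalType) :=
  Topological.copy (Ck R Z)
    (initial_topology
      (fun f : continuousType Z R => (f : Z -> R) : {compact-open, Z -> R})).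

Definition evalCk (R : realType) (Z : topologicalType) (p : Z * Ck R Z) : R :=
  (p.2 : continuousType Z R) p.1.

(* Joint continuity on [set: Z] `*` K with the relative topology, so that the
   neighborhoods of f are taken in K and not in Ck R Z. *)
Definition evenly_continuous (R : realType) (Z : topologicalType)
    (K : set (Ck R Z)) : Prop :=
  {within [set: Z] `*` K, continuous (@evalCk R Z)}.

Definition tychonoff_space (Z : topologicalType) : Prop :=
  hausdorff_space Z /\ completely_regular_space Z.

Definition ascoli_space (R : realType) (Z : topologicalType) : Prop :=
  tychonoff_space Z /\
  forall K : set (Ck R Z), compact K -> evenly_continuous K.

Definition dual (R : realType) (E : normedModType R) : Type :=
  {f : {linear E -> R^o} | continuous f}.

(* The coarsest topology on E making every element of the topological dual
   continuous. weak E is convertible to E but carries its own topology. *)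
Definition weak (R : realType) (E : normedModType R) : Type :=
  sup_topology (fun f : dual E => Topological.class (initial_topology (sval f))).

HB.instance Definition _ (R : realType) (E : normedModType R) :=
  Topological.copy (weak E)
    (sup_topology
      (fun f : dual E => Topological.class (initial_topology (sval f)))).

Definition finite_dimensional (R : realType) (E : lmodType R) : Prop :=
  exists (n : nat) (e : 'I_n -> E),
    forall x : E, exists! c : 'rV[R]_n, x = \sum_(i < n) c 0 i *: e i.

(* Main.v *)
From HB Require Import structures.
Require Import Defs.
From mathcomp Require Import all_boot all_order all_algebra.
From mathcomp Require Import all_classical all_reals all_analysis.
From mathcomp Require Import finmap ring lra.

Set Implicit Arguments.
Unset Strict Implicit.
Unset Printing Implicit Defensive.

Import Order.TTheory GRing.Theory Num.Theory.
Import numFieldNormedType.Exports.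

Local Open Scope classical_set_scope.
Local Open Scope ring_scope.

(** Let [E] be a normed space.  If [E] is finite-dimensional, its coordinate
    functionals are bounded, so the weak topology is locally compact and
    Hausdorff.  It is then completely regular, and the evaluation map is jointly
    continuous on the whole of [E * C_k(E)], hence on every [E * K]
    ([locally_compact_ascoli]).

    Suppose now that [E] is infinite-dimensional and that its weak topology is
    Hausdorff.  The seminorm [dual_norm x], the supremum of [f x] over the unit
    ball of the dual, is then a norm.  Using it in place of the original norm
    makes functionals that almost attain it available by definition, so that the
    Hahn-Banach theorem is not needed.  Two facts carry the argument.
    - Weakly compact sets are bounded for [dual_norm]
      ([weakly_bounded_dual_norm]).
    - For each [n] there is a finite set [A n] of vectors of [dual_norm] greater
      than [n + 1] on which any [n] given functionals are simultaneously small
      at some point ([finite_almost_annihilated]); so every weak neighborhood of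
      the origin meets [A n] for all large [n].

    For [a] in [A n] pick [phi] in the dual ball with [phi a > n + 1] and put
    [g x = max (0, phi x - n)].  This function is weakly continuous, vanishes
    where [dual_norm x <= n] and is at least 1 at [a].  By the first fact only
    finitely many of the [g] are not identically zero on a given weakly compact
    set, so that together with the zero function they form a compact subset of
    [C_k(E)].  By the second fact, evaluation on this set is not continuous at
    the pair of the origin and the zero function. *)

(** * The dual and the weak topology *)

Lemma dual_linear (R : realType) (E : normedModType R) (f : dual E) (a : R)
    (x y : E) :
  sval f (a *: x + y) = a * sval f x + sval f y :> R.
Proof. by rewrite linearP. Qed.

Lemma dual_bound (R : realType) (E : normedModType R) (f : dual E) :
  exists2 L : R, 0 < L & forall x, `|sval f x| <= L * `|x|.
Proof.
have /linear_bounded_continuous/linear_boundedP/pinfty_ex_gt0[L L0 fL] :=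
  svalP f.
by exists L.
Qed.

(** A linear form bounded by a multiple of the norm is an element of the
    dual. *)
Lemma dual_of_bounded (R : realType) (E : normedModType R) (g : E -> R)
    (M : R) :
  (forall a x y, g (a *: x + y) = a * g x + g y) ->
  (forall x, `|g x| <= M * `|x|) ->
  exists f : dual E, forall x, sval f x = g x.
Proof.
move=> glin gM.
have glin' : linear (g : E -> R^o) by move=> a x y; rewrite glin.
pose gL := GRing.isLinear.Build R E R^o _ (g : E -> R^o) glin'.
pose G : {linear E -> R^o} := HB.pack (g : E -> R^o) gL.
have Gc : continuous G.
  apply/linear_bounded_continuous/linear_boundedP.
  exists M; split; first exact: num_real.
  by move=> r Mr x; apply: le_trans (gM x) _; rewrite ler_wpM2r// ltW.
by exists (exist _ G Gc).
Qed.

Lemma cvg_initialP (S : choiceType) (T : topologicalType) (f : S -> T)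
    (F : set_system S) (x : S) : Filter F ->
  F --> (x : initial_topology f) <-> f y @[y --> F] --> f x.
Proof.
move=> FF; split=> [Fx A /(@initial_continuous _ _ f x)|Fx A]; first exact: Fx.
move=> -[B [[C oC CB] Bx] BA]; rewrite nbhs_filterE; apply: (filterS BA).
rewrite -CB; apply: Fx; apply: open_nbhs_nbhs; split=> //.
by move: Bx; rewrite -CB.
Qed.

(** The universal property of the weak topology, for filters. *)
Lemma weak_cvgP (R : realType) (E : normedModType R) (F : set_system E)
    (x : E) : Filter F ->
  F --> (x : weak E) <-> forall f : dual E, sval f y @[y --> F] --> sval f x.
Proof.
move=> FF; split=> [/cvg_sup Fx f|Fx]; first by apply/cvg_initialP/(Fx f).
by apply/cvg_sup => f; apply/cvg_initialP; exact: Fx.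
Qed.

Lemma dual_weak_continuous (R : realType) (E : normedModType R) (f : dual E) :
  continuous (sval f : weak E -> R).
Proof.
move=> x; have /weak_cvgP : nbhs (x : weak E) --> (x : weak E) by exact: cvg_id.
exact.
Qed.

Lemma weak_hausdorff_separated (R : realType) (E : normedModType R) (x : E) :
  hausdorff_space (weak E) -> (forall f : dual E, sval f x = 0) -> x = 0.
Proof.
move=> hE fx0.
(* No functional tells [x] from 0, so weak neighborhoods do not either. *)
apply: (@cvg_unique (weak E) hE (nbhs (0 : weak E))) => //.
apply/weak_cvgP => f; rewrite fx0 -(linear0 (sval f)).
exact: dual_weak_continuous.
Qed.

(** * The seminorm defined by the dual ball *)

(** The closed unit ball of the dual. *)
Definition dual_ball (R : realType) (E : normedModType R) : set (dual E) :=
  [set f : dual E | forall x : E, `|sval f x| <= `|x|].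

(** The norm of [x] as a functional on the dual.  It is at most [`|x|] and is
    only a seminorm when the dual does not separate the points of [E]. *)
Definition dual_norm (R : realType) (E : normedModType R) (x : E) : R :=
  sup [set (sval f x : R) | f in @dual_ball R E].

Section dual_norm.
Variables (R : realType) (E : normedModType R).
Implicit Types (x y : E) (f : dual E).

Lemma zero_dual_ball : exists2 f : dual E, dual_ball f & forall x, sval f x = 0.
Proof.
have [|x|f f0] := @dual_of_bounded R E (fun=> 0) 0.
- by move=> *; rewrite mulr0 addr0.
- by rewrite normr0 mul0r.
by exists f => // x; rewrite f0 normr0.
Qed.

Lemma opp_dual_ball f : dual_ball f ->
  exists2 g : dual E, dual_ball g & forall x, sval g x = - sval f x.
Proof.
move=> fB; have [|x|g gf] := @dual_of_bounded R E (fun x => - sval f x) 1.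
- by move=> a x y; rewrite dual_linear opprD mulrN.
- by rewrite normrN mul1r; exact: fB.
by exists g => // x; rewrite gf normrN; exact: fB.
Qed.

Lemma dual_norm_has_sup x : has_sup [set (sval f x : R) | f in @dual_ball R E].
Proof.
split; first by have [f fB _] := zero_dual_ball; exists (sval f x), f.
by exists `|x| => _ [f fB <-]; exact: le_trans (ler_norm _) (fB x).
Qed.

Lemma ler_dual_norm f x : dual_ball f -> `|sval f x| <= dual_norm x.
Proof.
move=> fB; have leB g : dual_ball g -> sval g x <= dual_norm x.
  by move=> gB; apply: ub_le_sup; [exact: (dual_norm_has_sup x).2|exists g].
rewrite ler_norml leB// andbT lerNl.
by have [g gB <-] := opp_dual_ball fB; exact: leB.
Qed.

Lemma dual_norm_le_bound x (M : R) :
  (forall f, dual_ball f -> sval f x <= M) -> dual_norm x <= M.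
Proof.
move=> fM; apply: ge_sup; first exact: (dual_norm_has_sup x).1.
by move=> _ [f fB <-]; exact: fM.
Qed.

Lemma dual_norm_approx x (r : R) : r < dual_norm x ->
  exists2 f, dual_ball f & r < sval f x.
Proof.
by move=> /sup_gt[|_ [f fB <-] rf]; [exact: (dual_norm_has_sup x).1|exists f].
Qed.

Lemma dual_norm_ge0 x : 0 <= dual_norm x.
Proof.
by have [f fB _] := zero_dual_ball; exact: le_trans (ler_dual_norm x fB).
Qed.

Lemma dual_norm_le_norm x : dual_norm x <= `|x|.
Proof.
by apply: dual_norm_le_bound => f fB; exact: le_trans (ler_norm _) (fB x).
Qed.

Lemma dual_norm_dist x y : dual_norm x <= dual_norm y + `|x - y|.
Proof.
apply: dual_norm_le_bound => f fB; rewrite -[x in sval f x](subrK y) linearD.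
rewrite addrC lerD//; first exact: le_trans (ler_norm _) (ler_dual_norm y fB).
exact: le_trans (ler_norm _) (fB _).
Qed.

Lemma dual_normZ (a : R) x : dual_norm (a *: x) = `|a| * dual_norm x.
Proof.
(* The converse inequality follows by applying this one to [a^-1]. *)
have half (b : R) (z : E) : dual_norm (b *: z) <= `|b| * dual_norm z.
  apply: dual_norm_le_bound => f fB; apply: le_trans (ler_norm _) _.
  by rewrite linearZ normrM ler_wpM2l//; exact: ler_dual_norm.
apply/eqP; rewrite eq_le half/=.
have [->|a0] := eqVneq a 0; first by rewrite normr0 mul0r dual_norm_ge0.
rewrite -ler_pdivlMl ?normr_gt0// -normfV.
by rewrite -[x in dual_norm x](scalerK a0).
Qed.

(** When the weak topology is Hausdorff, the seminorm [dual_norm] is a norm. *)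
Lemma dual_norm_eq0 x : hausdorff_space (weak E) -> dual_norm x = 0 -> x = 0.
Proof.
move=> hE x0; apply: weak_hausdorff_separated => // f.
have [L L0 fL] := dual_bound f.
have [||g gf] := @dual_of_bounded R E (fun y => L^-1 * sval f y) 1.
- by move=> a y z; rewrite dual_linear mulrDr mulrCA.
- move=> y; rewrite normrM gtr0_norm ?invr_gt0// mul1r ler_pdivrMl//.
have gB : dual_ball g.
  move=> y; rewrite gf normrM gtr0_norm ?invr_gt0// ler_pdivrMl//.
have := ler_dual_norm x gB; rewrite x0 normr_le0 gf mulf_eq0 invr_eq0.
by rewrite gt_eqF//= => /eqP.
Qed.

End dual_norm.

(** * Uniform boundedness *)

(** If [u] moves by at most [C / 3 ^ n] at each step, then it converges, and
    its limit is within [3 / 2 * C / 3 ^ n] of [u n]. *)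
Lemma geometric_steps_cvg (R : realType) (u : R^nat) (C : R) :
  (forall n, `|u n.+1 - u n| <= 3^-1 ^+ n * C) ->
  exists2 l : R, u @ \oo --> l &
    forall n, `|l - u n| <= 3 / 2 * (3^-1 ^+ n * C).
Proof.
move=> uC; have C0 : 0 <= C.
  by have := uC 0%N; rewrite expr0 mul1r; exact: le_trans.
have q0 n : 0 <= (3^-1 : R) ^+ n by rewrite exprn_ge0// invr_ge0.
have step n : 3^-1 ^+ n.+1 * C = 3^-1 * (3^-1 ^+ n * C) :> R.
  by rewrite exprS mulrA.
have dist n k : `|u (n + k)%N - u n|
    <= 3 / 2 * (3^-1 ^+ n * C) - 3 / 2 * (3^-1 ^+ (n + k) * C).
  elim: k => [|k IHk]; first by rewrite addn0 !subrr normr0.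
  rewrite addnS; have := uC (n + k)%N; rewrite step.
  move: IHk; rewrite !ler_norml => /andP[? ?] /andP[? ?].
  by apply/andP; split; lra.
(* Subtracting the error bound makes the sequence monotone. *)
pose v n := u n - 3 / 2 * (3^-1 ^+ n * C).
have v_nd : nondecreasing_seq v.
  apply/nondecreasing_seqP => n; rewrite /v step.
  by have := uC n; rewrite ler_norml => /andP[? ?]; lra.
have v_ub : has_ubound (range v).
  exists (u 0%N + 3 / 2 * C) => _ [n _ <-]; rewrite /v.
  have := dist 0%N n; rewrite add0n expr0 mul1r ler_norml => /andP[_].
  have : 0 <= 3^-1 ^+ n * C by rewrite mulr_ge0.
  by lra.
have vl := nondecreasing_is_cvgn v_nd v_ub.
have ul : u @ \oo --> lim (v @ \oo).
  have -> : u = (fun n => v n + (3 / 2 * C) * 3^-1 ^+ n).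
    by apply/funext => n; rewrite /v; lra.
  rewrite -[X in _ --> X]addr0 -[X in _ + X](mulr0 (3 / 2 * C)).
  apply: cvgD => //; apply: cvgMl_tmp; apply: cvg_expr.
  by rewrite ger0_norm ?invr_ge0//; lra.
exists (lim (v @ \oo)) => // n.
have ln : `|u k - u n| @[k --> \oo] --> `|lim (v @ \oo) - u n|.
  by apply: cvg_norm; apply: cvgB => //; exact: cvg_cst.
rewrite -(cvg_lim _ ln)//; apply: limr_le.
  by apply/cvg_ex; eexists; exact: ln.
near=> k; have nk : (n <= k)%N by near: k; exact: nbhs_infty_ge.
have := dist n (k - n)%N; rewrite subnKC// => /le_trans; apply.
by rewrite lerBlDr lerDl mulr_ge0// mulr_ge0.
Unshelve. all: by end_near. Qed.

Lemma sign_norm_le (R : realDomainType) (a b : R) :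
  exists2 s : R, `|s| = 1 & `|b| <= `|a + s * b|.
Proof.
have [ab|ab] := leP `|b| `|a + b|; first by exists 1; rewrite ?normr1 ?mul1r.
exists (-1); rewrite ?normrN1// mulN1r.
have := ler_normB (a + b) (a - b).
have -> : a + b - (a - b) = 2 * b by ring.
by rewrite normrM ger0_norm//; lra.
Qed.

(** A form of the uniform boundedness principle: a weakly bounded set is
    bounded for [dual_norm].  If not, choose points [x k] of the set with
    [dual_norm (x k)] very large and functionals [phi k] of the unit ball almost
    attaining it; for a suitable choice of signs the functional
    [\sum_k (+/-) 3 ^- k * phi k] is unbounded on the points [x k], since its
    partial sum up to [k] has size at least [2 / 3 * 3 ^- k * dual_norm (x k)]
    at [x k] while the remaining terms contribute at most
    [1 / 2 * 3 ^- k * dual_norm (x k)]. *)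
Lemma weakly_bounded_dual_norm (R : realType) (E : normedModType R)
    (C : set E) :
  (forall f : dual E, exists M : R, forall x, C x -> `|sval f x| <= M) ->
  exists M : R, forall x, C x -> dual_norm x <= M.
Proof.
move=> Cb; apply: contrapT => /forallNP Cub.
(* The factor 6 leaves [k] after the estimate by [(2 / 3 - 1 / 2) / 3 ^ k]. *)
have /choice[x xP] : forall k : nat, exists x, C x /\
    6 * 3 ^+ k * k%:R < dual_norm x :> R.
  move=> k; apply: contrapT => /forallNP nx.
  apply: (Cub (6 * 3 ^+ k * k%:R)) => x Cx; rewrite leNgt; apply/negP => xk.
  exact: (nx x).
have /choice[phi phiP] : forall k : nat, exists f : dual E, dual_ball f /\
    2 / 3 * dual_norm (x k) <= sval f (x k).
  move=> k; have [x0|] := leP (dual_norm (x k)) 0.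
    have [f fB f0] := zero_dual_ball E; exists f; split=> //.
    by rewrite f0; lra.
  move=> x0; have [|f fB ff] := @dual_norm_approx _ _ (x k)
    (2 / 3 * dual_norm (x k)); first by lra.
  by exists f; split=> //; exact: ltW.
have q0 n : 0 < (3^-1 : R) ^+ n by rewrite exprn_gt0// invr_gt0.
have /choice[sg' sg'P] : forall p : nat * R, exists s : R, `|s| = 1 /\
    `|3^-1 ^+ p.1 * sval (phi p.1) (x p.1)| <=
    `|p.2 + s * (3^-1 ^+ p.1 * sval (phi p.1) (x p.1))|.
  by move=> [k a]; have [s] := sign_norm_le a (3^-1 ^+ k * sval (phi k) (x k));
    exists s.
pose sg k a := sg' (k, a).
have sgP k a : `|sg k a| = 1 /\
    `|3^-1 ^+ k * sval (phi k) (x k)| <=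
    `|a + sg k a * (3^-1 ^+ k * sval (phi k) (x k))| := sg'P (k, a).
pose psi : nat -> E -> R := fix psi k := if k is j.+1 then
  fun y => psi j y + sg j (psi j (x j)) * (3^-1 ^+ j * sval (phi j) y)
  else fun=> 0.
have psiS k y : psi k.+1 y =
  psi k y + sg k (psi k (x k)) * (3^-1 ^+ k * sval (phi k) y) by [].
have psi_lin k a y z : psi k (a *: y + z) = a * psi k y + psi k z.
  elim: k => [|k IHk]; first by rewrite /= mulr0 addr0.
  by rewrite !psiS IHk dual_linear; ring.
have psi_step k y : `|psi k.+1 y - psi k y| <= 3^-1 ^+ k * dual_norm y.
  rewrite psiS addrC addKr !normrM (sgP k _).1 mul1r gtr0_norm//.
  by rewrite ler_pM2l//; apply: ler_dual_norm; exact: (phiP k).1.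
have /choice[Psi PsiP] : forall y, exists l : R, psi ^~ y @ \oo --> l /\
    forall n, `|l - psi n y| <= 3 / 2 * (3^-1 ^+ n * dual_norm y).
  move=> y; have [l ? ?] := geometric_steps_cvg (fun n => psi_step n y).
  by exists l.
have [|y|f fP] := @dual_of_bounded R E Psi (3 / 2).
- move=> a y z.
  apply: (@cvg_unique _ _ (psi n (a *: y + z) @[n --> \oo])) => //.
    exact: (PsiP _).1.
  rewrite /= [X in X @ _ --> _](_ : _ = fun n => a * psi n y + psi n z);
    last by apply/funext => n; exact: psi_lin.
  by apply: cvgD; [apply: cvgMl_tmp|]; exact: (PsiP _).1.
- have := (PsiP y).2 0%N; rewrite /= subr0 expr0 mul1r => /le_trans; apply.
  by rewrite ler_pM2l// dual_norm_le_norm.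
have [M MP] := Cb f.
pose k := Num.bound `|M|.
have Mk : `|M| < k%:R := archi_boundP (normr_ge0 M).
have := MP _ (xP k).1; rewrite fP.
have := (PsiP (x k)).2 k.+1; rewrite psiS.
have := (sgP k (psi k (x k))).2.
set P := psi k (x k) + _; set W := dual_norm (x k).
rewrite normrM (gtr0_norm (q0 k)) exprS => tP.
have tphi : 3^-1 ^+ k * (2 / 3 * W) <= 3^-1 ^+ k * `|sval (phi k) (x k)|.
  by rewrite ler_pM2l//; exact: le_trans (phiP k).2 (ler_norm _).
have tW : 6 * k%:R < 3^-1 ^+ k * W.
  rewrite exprVn ltr_pdivlMl ?exprn_gt0//.
  by have := (xP k).2; rewrite -/W; lra.
have := ler_norm M; have := lerB_dist P (Psi (x k)); rewrite distrC.
by lra.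
Qed.

(** * Linear combinations of finite families *)

(** The vector with coefficients [c] on the family [e]. *)
Definition lincomb (R : realType) (E : lmodType R) n (e : 'I_n -> E)
    (c : 'rV[R]_n) : E := \sum_(i < n) c 0 i *: e i.

Lemma rV_sphere_compact (R : realType) n :
  compact [set c : 'rV[R]_n | `|c| = 1].
Proof.
apply: bounded_closed_compact.
  exists 1; split; first exact: num_real.
  by move=> r r1 c /= ->; exact: ltW.
apply: (@closed_comp _ _ (fun c : 'rV[R]_n => `|c|) [set 1]).
  by move=> c _; exact: norm_continuous.
exact: closed_eq.
Qed.

Section lincomb.
Variables (R : realType) (E : normedModType R) (n : nat) (e : 'I_n -> E).
Implicit Types c d : 'rV[R]_n.

Lemma lincombP (a : R) c d :
  lincomb e (a *: c + d) = a *: lincomb e c + lincomb e d.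
Proof.
rewrite /lincomb scaler_sumr -big_split/=; apply: eq_bigr => i _.
by rewrite !mxE scalerDl scalerA.
Qed.

HB.instance Definition _ :=
  GRing.isLinear.Build R 'rV[R]_n E _ (lincomb e) lincombP.

Lemma norm_normalize c : c != 0 -> `|(`|c|^-1 *: c)| = 1.
Proof.
by move=> c0; rewrite normrZ ger0_norm ?invr_ge0// mulVf// normr_eq0.
Qed.

Lemma norm_rV_coord c i : `|c 0 i| <= `|c|.
Proof.
rewrite -[leRHS]/(mx_norm c) mx_normrE.
exact: (le_bigmax _ (fun ij : 'I_1 * 'I_n => `|c ij.1 ij.2|) (0, i)).
Qed.

Lemma norm_lincomb_le c : `|lincomb e c| <= (\sum_(i < n) `|e i|) * `|c|.
Proof.
rewrite /lincomb (le_trans (ler_norm_sum _ _ _))// mulr_suml ler_sum// => i _.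
by rewrite normrZ mulrC ler_wpM2l// norm_rV_coord.
Qed.

Lemma lincomb_continuous : continuous (lincomb e).
Proof.
apply/linear_bounded_continuous/linear_boundedP.
exists (\sum_(i < n) `|e i|); split; first exact: num_real.
move=> r Mr x; apply: le_trans (norm_lincomb_le x) _.
by rewrite ler_wpM2r// ltW.
Qed.

(** A definite seminorm dominated by the norm is, on the span of a free family,
    bounded below by a multiple of the norm of the coefficients: it has a
    positive minimum on the image of the unit sphere.  Of the triangle
    inequality only the Lipschitz bound is used. *)
Lemma lincomb_lower_bound (p : E -> R) :
  (forall c, lincomb e c = 0 -> c = 0) ->
  (forall x y, p x <= p y + `|x - y|) ->
  (forall a x, p (a *: x) = `|a| * p x) ->
  (forall x, 0 <= p x) -> (forall x, p x = 0 -> x = 0) ->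
  exists2 delta : R, 0 < delta & forall c, delta * `|c| <= p (lincomb e c).
Proof.
move=> efree plip pZ p_ge0 p_eq0.
pose S := [set c : 'rV[R]_n | `|c| = 1].
have normalize c : c != 0 -> S (`|c|^-1 *: c) := @norm_normalize c.
have [[c0 Sc0]|/set0P/negP/negPn/eqP S0] := pselect (S !=set0); last first.
  exists 1 => // c; rewrite mul1r; have [->|/normalize] := eqVneq c 0.
    by rewrite normr0.
  by rewrite S0.
have Scpt : compact S := @rV_sphere_compact R n.
have pc : continuous (p \o lincomb e).
  move=> c; apply: (@continuous_comp _ _ _ _ p).
    exact: lincomb_continuous.
  apply/(@cvgrPdist_lt _ R^o) => eps eps0; near=> y.
  have : `|lincomb e c - y| < eps.
    by near: y; apply: cvgr_dist_lt.
  apply: le_lt_trans; rewrite ler_norml.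
  have := plip (lincomb e c) y; have := plip y (lincomb e c).
  by rewrite distrC => *; apply/andP; split; lra.
have [c1 Sc1 minc1] := compact_EVT_min (ex_intro _ _ Sc0) Scpt
  (continuous_subspaceT pc).
have d0 : 0 < p (lincomb e c1).
  rewrite lt_neqAle p_ge0 andbT eq_sym; apply/eqP => /p_eq0/efree c10.
  have /eqP := set_mem Sc1.
  by rewrite c10 normr0 eq_sym oner_eq0.
exists (p (lincomb e c1)) => // c; have [->|cN0] := eqVneq c 0.
  by rewrite normr0 mulr0.
have := minc1 (`|c|^-1 *: c) (mem_set (normalize c cN0)).
rewrite /= linearZ pZ ger0_norm ?invr_ge0// ler_pdivlMl ?normr_gt0//.
by rewrite mulrC.
Unshelve. all: by end_near. Qed.

End lincomb.

(** * Almost common zeros of finitely many functionals *)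

Lemma infinite_dimensional_free (R : realType) (E : normedModType R) n :
  ~ finite_dimensional E ->
  exists e : 'I_n -> E, forall c, lincomb e c = 0 -> c = 0.
Proof.
move=> infE; elim: n => [|n [e efree]].
  by exists (fun=> 0) => c _; apply/rowP => -[].
have [x xNe] : exists x, forall c, x <> lincomb e c.
  apply: contrapT => /forallNP espan; apply: infE; exists n, e => x.
  have [c xc] : exists c, x = lincomb e c.
    by apply: contrapT => /forallNP xNe; exact: (espan x).
  exists c; split=> // d xd; apply/eqP; rewrite -subr_eq0; apply/eqP.
  by apply: efree; rewrite linearB/= -xc (_ : lincomb e d = x) ?subrr.
exists (fun i => if unlift ord0 i is Some j then e j else x) => c.
pose d : 'rV[R]_n := \row_j c 0 (lift ord0 j).
rewrite /lincomb big_ord_recl unlift_none.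
under eq_bigr do rewrite liftK.
rewrite (_ : \sum_(i < n) _ = lincomb e d); last first.
  by apply: eq_bigr => i _; rewrite mxE.
have [c0|c0] := eqVneq (c 0 ord0) 0.
  rewrite c0 scale0r add0r => /efree d0; apply/rowP => i; rewrite mxE.
  have [j ->|->//] := unliftP ord0 i.
  by move/rowP/(_ j): d0; rewrite !mxE.
move=> /eqP; rewrite addr_eq0 => /eqP xd; exfalso.
apply: (xNe (- (c 0 ord0)^-1 *: d)); rewrite linearZ/= scaleNr -scalerN -xd.
by rewrite scalerK.
Qed.

(** An [n.+1]-dimensional subspace contains, on its sphere, a common zero of
    any [n] functionals.  The sphere being compact, one finite subset of it
    approximates all these common zeros; a dilation then makes [dual_norm]
    large.  The set [A] depends on [n] only, not on the functionals. *)
Lemma finite_almost_annihilated (R : realType) (E : normedModType R) n :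
  hausdorff_space (weak E) -> ~ finite_dimensional E ->
  exists A : set E, [/\ finite_set A, (forall a, A a -> n.+1%:R < dual_norm a) &
    forall (I : finType) (f : I -> dual E) (L : R), (#|I| <= n)%N -> 0 <= L ->
      (forall i x, `|sval (f i) x| <= L * `|x|) ->
      exists2 a, A a & forall i, `|sval (f i) a| <= L / n.+1%:R].
Proof.
move=> hE infE; have [e efree] := infinite_dimensional_free n.+1 infE.
have [delta delta0 lower] := lincomb_lower_bound efree (@dual_norm_dist R E)
  (@dual_normZ R E) (@dual_norm_ge0 R E) (fun x => dual_norm_eq0 hE).
(* [M] brings the points [M *: lincomb e c], with [c] on the sphere, above
   [n.+1] in [dual_norm]; the mesh [eta] keeps the error on a functional of norm
   at most [L] within [L / n.+1]. *)
pose B := \sum_(i < n.+1) `|e i| + 1; pose M := n.+2%:R / delta.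
have B0 : 0 < B by rewrite ltr_wpDl// sumr_ge0.
have M0 : 0 < M by rewrite divr_gt0.
pose eta := (M * B * n.+1%:R)^-1.
have eta0 : 0 < eta by rewrite invr_gt0 mulr_gt0 ?(mulr_gt0 M0).
have : cover_compact [set c : 'rV[R]_n.+1 | `|c| = 1].
  by rewrite -compact_cover; exact: rV_sphere_compact.
move=> /(_ _ [set c : 'rV[R]_n.+1 | `|c| = 1] (fun c => ball c eta)).
case=> [c _|c Sc|D DS Dcover]; first exact: ball_open.
  by exists c => //; exact: ballxx.
exists ((fun c => M *: lincomb e c) @` [set` D]); split.
- exact/finite_image/finite_fset.
- move=> _ [c /= cD <-]; have c1 : `|c| = 1 := set_mem (DS _ cD).
  rewrite dual_normZ gtr0_norm// (@lt_le_trans _ _ (M * delta))//.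
    by rewrite /M divfK ?gt_eqF// ltr_nat.
  by rewrite ler_pM2l//; have := lower c; rewrite c1 mulr1.
move=> I f L In L0 fL.
pose F : 'M[R]_(n.+1, #|I|) := \matrix_(i, j) sval (f (enum_val j)) (e i).
(* [F] has more rows than columns: its kernel holds a common zero. *)
have /rowV0Pn[v /sub_kermxP vF v0] : kermx F != 0.
  rewrite kermx_eq0 /row_free neq_ltn; apply/orP; left.
  by rewrite ltnS (leq_trans (rank_leq_col _)).
have vanish i : sval (f i) (lincomb e v) = 0.
  rewrite /lincomb linear_sum/= -[i]enum_rankK.
  have /matrixP/(_ 0 (enum_rank i)) := vF; rewrite !mxE => vF0.
  rewrite -[RHS]vF0; apply: eq_bigr => j _.
  by rewrite linearZ !mxE.
have [c /= cD cv] := Dcover _ (norm_normalize v0).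
exists (M *: lincomb e c); first by exists c.
move=> i; set u := `|v|^-1 *: v in cv.
have -> : sval (f i) (M *: lincomb e c) = sval (f i) (M *: lincomb e (c - u)).
  rewrite linearZ [RHS]linearZ; congr (_ *: _).
  rewrite linearB/= linearB/= [lincomb e u]linearZ/= [X in _ - X]linearZ/=.
  by rewrite vanish scaler0 subr0.
apply: le_trans (fL _ _) _; rewrite ler_wpM2l// normrZ gtr0_norm//.
have cu : `|c - u| <= eta.
  by move: cv; rewrite -ball_normE/= => /ltW.
have : `|lincomb e (c - u)| <= B * eta.
  apply: le_trans (norm_lincomb_le _ _) _; rewrite ler_pM// ?sumr_ge0//.
  by rewrite /B lerDl.
rewrite -(ler_pM2l M0) => /le_trans; apply.
by rewrite /eta mulrA invfM mulrA mulfV ?mul1r// gt_eqF// mulr_gt0.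
Qed.

(** * Infinite-dimensional spaces are not Ascoli *)

(** Take finitely many functions [H n] for each [n] such that, on any given
    compact set, those of large index vanish, while arbitrarily close to [z]
    some of arbitrarily large index take a value at least 1.  Together with the
    zero function they form a compact set which is not evenly continuous. *)
Lemma vanishing_family_not_ascoli (R : realType) (Z : topologicalType) (z : Z)
    (H : nat -> set (Ck R Z)) :
  (forall n, finite_set (H n)) ->
  (forall C : set Z, compact C -> exists N, forall n h x, (N <= n)%N ->
    H n h -> C x -> evalCk (x, h) = 0) ->
  (forall O N, nbhs z O -> exists n h y, [/\ (N <= n)%N, H n h, O y &
    1 <= evalCk (y, h)]) ->
  exists2 K : set (Ck R Z), compact K & ~ evenly_continuous K.
Proof.
move=> Hfin Hvanish Hbig.
have zero_cts : continuous (fun _ : Z => 0 : R) by move=> ?; exact: cvg_cst.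
pose zero : Ck R Z := (mkcts zero_cts : continuousType Z R).
(* The filter generated by the tails of [H]. *)
pose G : set_system (Ck R Z) :=
  filter_from setT (fun N => [set h | exists2 n, (N <= n)%N & H n h]).
have GF : Filter G.
  apply: filter_from_filter; first by exists 0%N.
  move=> i j _ _; exists (maxn i j) => // h [n].
  by rewrite geq_max => /andP[? ?] ?; split; exists n.
have G0 : G --> zero.
  apply/cvg_initialP/compact_open_cvgP => C O Ccpt _ CO.
  have [N NP] := Hvanish C Ccpt; exists N => // h [n Nn Hh] _ [x Cx <-].
  have -> : (h : continuousType Z R) x = 0 := NP n h x Nn Hh Cx.
  by apply: CO; exists x.
exists (zero |` \bigcup_n H n).
  move=> F FF FK; have [F0|] := pselect (cluster F zero).
    by exists zero; split=> //; left.
  move=> /existsNP[A] /existsNP[U] /not_implyP[FA] /not_implyP[U0 AU].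
  (* Here [F] contains a set [A] disjoint from a neighborhood [U] of zero, and
     [U] omits only finitely many functions of the family. *)
  have [N _ NU] := G0 _ U0.
  have fcpt : compact (\bigcup_(n in `I_N) H n).
    by apply: finite_compact; exact: bigcup_finite.
  have [|h [[n _ Hh] Fh]] := fcpt F FF; last first.
    by exists h; split=> //; right; exists n.
  apply: filterS (filterI FK FA) => h [[->|[n _ Hh]] Ah].
    by exfalso; apply: AU; exists zero; split=> //; exact: nbhs_singleton.
  have [nN|Nn] := ltnP n N; first by exists n.
  by exfalso; apply: AU; exists h; split=> //; apply: NU; exists n.
rewrite /evenly_continuous; set K := (K in _ `*` K).
move=> /subspace_continuousP Kc.
have zK : ([set: Z] `*` K) (z, zero) by split=> //; left.
have := Kc _ zK [set r | r < 1].
case=> [|[V U] [Vz U0] VU].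
  by apply: open_nbhs_nbhs; split; [exact: open_lt|exact: ltr01].
have [N _ NU] := G0 _ U0; have [n [h [y [Nn Hh Vy hy]]]] := Hbig V N Vz.
have : evalCk (y, h) < 1.
  apply: (VU (y, h)); first by split=> //; apply: NU; exists n.
  by split=> //; right; exists n.
by rewrite ltNge hy.
Qed.

Lemma compact_dual_norm_bounded (R : realType) (E : normedModType R)
    (C : set (weak E)) : compact C ->
  exists M : R, forall x, C x -> dual_norm (x : E) <= M.
Proof.
move=> Ccpt; apply: weakly_bounded_dual_norm => f.
have /compact_bounded[M [_ MP]] : compact ((sval f : weak E -> R^o) @` C).
  apply: continuous_compact => //; apply: continuous_subspaceT.
  exact: dual_weak_continuous.
by exists (M + 1) => x Cx; apply: (MP (M + 1)); [rewrite ltrDl|exists x].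
Qed.

(** Every weak neighborhood of the origin contains the set where the members of
    some finite family in the dual are all smaller than some [eps > 0]. *)
Lemma weak_nbhs0_contains (R : realType) (E : normedModType R)
    (O : set (weak E)) :
  nbhs (0 : weak E) O ->
  exists (I : finType) (f : I -> dual E) (eps : R), 0 < eps /\
    forall x : E, (forall i, `|sval (f i) x| < eps) -> O x.
Proof.
(* The sets with the required property form a filter, which converges weakly
   to 0. *)
pose G : set_system E := [set O | exists (I : finType) (f : I -> dual E)
  (eps : R), 0 < eps /\ forall x : E, (forall i, `|sval (f i) x| < eps) -> O x].
have GF : Filter G.
  split.
  - by exists void, (@of_void _), 1; split.
  - move=> A B [I [f [e [e0 fA]]]] [J [g [d [d0 gB]]]].
    exists (I + J)%type.
    exists (fun k => match k with inl i => f i | inr j => g j end).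
    exists (Num.min e d); split; first by rewrite lt_min e0 d0.
    move=> x xk; split; [apply: fA => i|apply: gB => j].
      by have := xk (inl i); rewrite lt_min => /andP[].
    by have := xk (inr j); rewrite lt_min => /andP[].
  - move=> A B AB [I [f [e [e0 fA]]]]; exists I, f, e; split=> // x xi.
    exact/AB/fA.
have : G --> (0 : weak E); last exact.
apply/weak_cvgP => f; rewrite linear0; apply/(@cvgrPdist_lt _ R^o) => e e0.
exists unit, (fun=> f), e; split=> // x /(_ tt).
by rewrite sub0r normrN.
Qed.

Lemma continuous_subr_max (R : realType) (T : topologicalType) (f : T -> R)
    (b : R) :
  continuous f -> continuous (fun x => Num.max 0 (f x - b)).
Proof.
move=> fc x; apply: (@continuous_max _ _ (fun=> 0) (fun y => f y - b)).
  exact: (@cst_continuous T R^o 0 x).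
by apply: cvgB; [exact: fc|exact: cvg_cst].
Qed.

Lemma infinite_dimensional_not_ascoli (R : realType) (E : normedModType R) :
  hausdorff_space (weak E) -> ~ finite_dimensional E ->
  exists2 K : set (Ck R (weak E)), compact K & ~ evenly_continuous K.
Proof.
move=> hE infE.
have /choice[A AP] := fun n => finite_almost_annihilated n hE infE.
have /choice[phi phiP] : forall p : nat * E, exists f : dual E,
    dual_ball f /\ (A p.1 p.2 -> p.1.+1%:R < sval f p.2).
  move=> [n a] /=; have [Aa|nAa] := pselect (A n a); last first.
    by have [f fB _] := zero_dual_ball E; exists f.
  have [_ /(_ a Aa)/dual_norm_approx[f fB fa] _] := AP n.
  by exists f.
have g_cts p : continuous
    (fun x : weak E => Num.max 0 (sval (phi p) x - p.1%:R) : R).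
  apply: continuous_subr_max; exact: dual_weak_continuous.
pose g p : Ck R (weak E) := (mkcts (g_cts p) : continuousType (weak E) R).
have gE p x : evalCk (x, g p) = Num.max 0 (sval (phi p) x - p.1%:R) by [].
apply: (@vanishing_family_not_ascoli _ _ (0 : weak E)
  (fun n => (fun a => g (n, a)) @` A n)).
- by move=> n; apply: finite_image; have [] := AP n.
- move=> C /compact_dual_norm_bounded[M MP]; exists (Num.bound `|M|).
  move=> n _ x Nn [a Aa <-] Cx; rewrite gE; apply/max_idPl.
  rewrite subr_le0; apply: le_trans (ler_norm _) _.
  apply: le_trans (ler_dual_norm _ (phiP (n, a)).1) _.
  apply: le_trans (MP _ Cx) _; apply: le_trans (ler_norm _) _.
  apply: le_trans (ltW (archi_boundP (normr_ge0 M))) _.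
  by rewrite ler_nat.
move=> O N /weak_nbhs0_contains[I [f [eps [eps0 fO]]]].
have /choice[L LP] : forall i, exists L : R, 0 < L /\
    forall x, `|sval (f i) x| <= L * `|x|.
  by move=> i; have [L ? ?] := dual_bound (f i); exists L.
pose S := \sum_i L i.
have LS i : L i <= S.
  by rewrite /S (bigD1 i)//= lerDl sumr_ge0// => j _; exact: ltW (LP j).1.
have S0 : 0 <= S by rewrite sumr_ge0// => j _; exact: ltW (LP j).1.
pose n := maxn (maxn N #|I|) (Num.bound (S / eps)).
have [_ big /(_ I f S)[||i x|a Aa small]] := AP n.
- by rewrite /n leq_max leq_max leqnn orbT.
- exact: S0.
- by apply: le_trans ((LP i).2 x) _; rewrite ler_wpM2r.
exists n, (g (n, a)), a; split.
- by rewrite /n !leq_max leqnn.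
- by exists a.
- apply: fO => i; apply: le_lt_trans (small i) _.
  rewrite ltr_pdivrMr// mulrC -ltr_pdivrMr//.
  apply: lt_trans (archi_boundP (divr_ge0 S0 (ltW eps0))) _.
  by rewrite ltr_nat ltnS /n leq_max leqnn orbT.
rewrite gE le_max; apply/orP; right.
by have := (phiP (n, a)).2 Aa; rewrite /= -natr1; lra.
Qed.

(** * Finite-dimensional spaces are Ascoli *)

Lemma evalCk_continuous (R : realType) (Z : topologicalType) :
  locally_compact [set: Z] -> hausdorff_space Z -> continuous (@evalCk R Z).
Proof.
move=> lcZ hZ.
pose ev (f : Ck R Z) (z : Z) : R := (f : continuousType Z R) z.
have evc : continuous (uncurry ev).
  apply: continuous_uncurry => //; first exact: initial_continuous.
  by move=> f; exact: (@cts_fun _ _ (f : continuousType Z R)).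
move=> zf; exact: (continuous_comp (@swap_continuous _ _ zf) (evc _)).
Qed.

Lemma locally_compact_ascoli (R : realType) (Z : topologicalType) :
  locally_compact [set: Z] -> hausdorff_space Z -> ascoli_space R Z.
Proof.
move=> lcZ hZ; split.
  by split=> //; exact: (locally_compact_completely_regular (R := R)).
move=> K _; apply: continuous_subspaceT; exact: evalCk_continuous.
Qed.

Lemma hausdorff_separating (X : topologicalType) (Y : topologicalType)
    (I : Type) (f : I -> X -> Y) : hausdorff_space Y ->
  (forall i, continuous (f i)) ->
  (forall p q, (forall i, f i p = f i q) -> p = q) -> hausdorff_space X.
Proof.
move=> hY fc sep p q pq; apply: sep => i; apply: hY => A B Ap Bq.
by have [x [Ax Bx]] := pq _ _ (fc i p _ Ap) (fc i q _ Bq); exists (f i x).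
Qed.

(** Coordinates in a finite basis are elements of the dual. *)
Lemma finite_dimensional_coordinates (R : realType) (E : normedModType R) :
  finite_dimensional E ->
  exists (n : nat) (e : 'I_n -> E) (phi : 'I_n -> dual E),
    forall x, x = lincomb e (\row_i sval (phi i) x).
Proof.
move=> [n [e eP]]; exists n, e.
have /choice[co coP] : forall x, exists c, x = lincomb e c.
  by move=> x; have [c [xc _]] := eP x; exists c.
have co_uniq x c : x = lincomb e c -> co x = c.
  move=> xc; have [d [_ dP]] := eP x.
  by rewrite -(dP _ xc) -(dP _ (coP x)).
have efree c : lincomb e c = 0 -> c = 0.
  by move=> c0; rewrite -(co_uniq 0 c)// (co_uniq 0 0)// linear0.
have [||||delta delta0 lower] :=
  @lincomb_lower_bound R E n e (fun x => `|x|) efree.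
- by move=> x y; rewrite -{1}(subrK y x) addrC ler_normD.
- by move=> a x; rewrite normrZ.
- by move=> x; exact: normr_ge0.
- by move=> x; exact: normr0_eq0.
have /choice[phi phiP] : forall i, exists f : dual E,
    forall x, sval f x = co x 0 i.
  move=> i; apply: (@dual_of_bounded _ _ _ delta^-1) => [a x y|x].
    rewrite (co_uniq (a *: x + y) (a *: co x + co y)); first by rewrite !mxE.
    by rewrite lincombP -!coP.
  rewrite ler_pdivlMl//; have := lower (co x); rewrite -coP; apply: le_trans.
  by rewrite ler_pM2l// norm_rV_coord.
exists phi => x; rewrite {1}(coP x); congr lincomb.
by apply/rowP => i; rewrite mxE phiP.
Qed.

Lemma finite_dimensional_weak_hausdorff (R : realType) (E : normedModType R) :
  finite_dimensional E -> hausdorff_space (weak E).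
Proof.
move=> /finite_dimensional_coordinates[n [e [phi phiP]]].
apply: (@hausdorff_separating (weak E) R^o 'I_n (fun i x => sval (phi i) x)).
- exact: norm_hausdorff.
- by move=> i; exact: dual_weak_continuous.
move=> p q pq; rewrite (phiP p) (phiP q); congr lincomb.
by apply/rowP => i; rewrite !mxE pq.
Qed.

Lemma finite_dimensional_weak_locally_compact (R : realType)
    (E : normedModType R) :
  finite_dimensional E -> locally_compact [set: weak E].
Proof.
move=> fE; have hE := finite_dimensional_weak_hausdorff fE.
have [n [e [phi phiP]]] := finite_dimensional_coordinates fE.
move=> x _.
pose co (y : E) : 'rV[R]_n := \row_i sval (phi i) y.
have Bcpt : compact [set c : 'rV[R]_n | `|co x - c| <= 1].
  apply: bounded_closed_compact; last exact: closed_closed_ball_.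
  exists (`|co x| + 1); split; first exact: num_real.
  move=> r r1 c /= c1; rewrite -(subKr (co x) c).
  by rewrite (le_trans (ler_normB _ _))// (le_trans _ (ltW r1))// lerD2l.
(* This image of a cube of coefficients is a compact neighborhood of [x]. *)
have Ucpt : compact ((lincomb e : 'rV[R]_n -> weak E) @`
    [set c : 'rV[R]_n | `|co x - c| <= 1]).
  apply: continuous_compact => //; apply: continuous_subspaceT => c.
  have FF : Filter (nbhs c) := nbhs_filter c.
  apply/weak_cvgP => f.
  exact: (continuous_comp (@lincomb_continuous _ _ _ e c) (svalP f _)).
eexists; last by split; [exact: Ucpt|exact: compact_closed].
rewrite withinET.
have : \forall y \near (x : weak E),
    forall i, `|sval (phi i) x - sval (phi i) y| < 1.
  have FF : Filter (nbhs (x : weak E)) := nbhs_filter (x : weak E).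
  apply: (filter_forall
    (f := fun i y => `|sval (phi i) x - sval (phi i) y| < 1) FF) => i.
  exact: (@cvgr_dist_lt _ R^o _ _ _ _ _ (@dual_weak_continuous R E (phi i) x)).
apply: filterS => y xy; exists (co y) => /=; last by rewrite -phiP.
rewrite -[leLHS]/(mx_norm _) mx_normrE; apply: bigmax_le => // -[i j] _ /=.
by rewrite ord1 !mxE ltW.
Qed.

Theorem theorem1p5 (R : realType) (E : completeNormedModType R) :
  ascoli_space R (weak E) <-> finite_dimensional E.
Proof.
split=> [[[hE _] aE]|fE].
  apply: contrapT => infE.
  by have [K Kcpt] := infinite_dimensional_not_ascoli hE infE; apply; exact: aE.
apply: locally_compact_ascoli.
  exact: finite_dimensional_weak_locally_compact.
exact: finite_dimensional_weak_hausdorff.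
Qed.
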